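(* Let $\mathcal A$ be a four-dimensional partially alternative unital real division algebra that possesses a reflection. Assume that $\mathcal A$ has at least three imaginary units. Then there exist $g,h\in\mathbb R$ and a basis $\{1,i,j,k\}$ of $\mathcal A$ (with $1$ the unit) with the following multiplication table (the entry in row $x$ and column $y$ is $xy$): $$(T_d)\qquad\begin{array}{c|cccc} & 1 & i & j & k\\ \hline 1 & 1 & i & j & k\\ i & i & -1 & -k & j\\ j & j & k & -1 & -i\\ k & k & -j & i & g1+hi\end{array}$$ The converse is also true: any four-dimensional real division algebra having a basis with multiplication table $(T_d)$ with $h\neq 0$ is partially alternative. If a four-dimensional real division algebra $\mathcal A$ has a basis with multiplication table $(T_d)$ with $h=0$, then $\mathcal A$ is partially alternative if and only if $g=-1$; in the latter case (that is, $h=0$ and $g=-1$), $\mathcal A$ is isomorphic to the real quaternion algebra.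
   Context: Algebras are real vector spaces with a bilinear product, not necessarily associative or commutative. A finite-dimensional real algebra is a division algebra if left and right multiplications by every nonzero element are bijective (equivalently, $xy=0$ implies $x=0$ or $y=0$). For a real algebra $\mathcal A$ with unit $1$, an imaginary unit is an element $q\in\mathcal A$ with $q^2=-1$, and $\mathcal I_{\mathcal A}$ is the set of all imaginary units. With $(a,b,c)=(ab)c-a(bc)$, the unital real algebra $\mathcal A$ is partially alternative if $\mathcal I_{\mathcal A}\neq\emptyset$ and $(x,x,y)=0$, $(x,y,x)=0$, $(y,x,x)=0$ for all $x\in\mathcal I_{\mathcal A}$ and $y\in\mathcal A$. A reflection is a nontrivial algebra automorphism of order $2$. *)

(* Defs.v *)
From HB Require Import structures.
From mathcomp Require Import all_boot all_order all_algebra ring.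
From mathcomp Require Import classical_sets reals.

Set Implicit Arguments.
Unset Strict Implicit.
Unset Printing Implicit Defensive.

Import GRing.Theory.
Local Open Scope ring_scope.
Local Open Scope classical_set_scope.

(* Not assumed associative, commutative or unital; [vectType] makes the algebra
   finite-dimensional. *)
Record algebra (R : realType) := Algebra {
  algebra_sort :> vectType R;
  amul : {bilinear algebra_sort -> algebra_sort -> algebra_sort} }.

Declare Scope algebra_scope.
Delimit Scope algebra_scope with alg.
Notation "x ** y" := (amul _ x y)
  (at level 40, left associativity) : algebra_scope.
Local Open Scope algebra_scope.

Section Algebra.
Variables (R : realType) (A : algebra R).
Implicit Types (e q x y z : A) (g h : R).

Definition division_algebra : Prop :=
  forall x, x != 0 ->
    bijective (fun y : A => x ** y) /\ bijective (fun y : A => y ** x).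

(* Such an [e] is unique when it exists, so that the definitions below which
   quantify over it, or take it as a parameter, speak about the unit of A. *)
Definition is_unit e : Prop := forall x, e ** x = x /\ x ** e = x.

Definition imaginary_units e : set A := [set q | q ** q = - e].

Definition associator x y z : A := (x ** y) ** z - x ** (y ** z).

Definition partially_alternative : Prop :=
  exists e, [/\ is_unit e,
    imaginary_units e !=set0 &
    forall x y, imaginary_units e x ->
      [/\ associator x x y = 0, associator x y x = 0 & associator y x x = 0]].

Definition automorphism (f : {linear A -> A}) : Prop :=
  bijective f /\ {morph f : x y / x ** y}.

Definition reflection (f : {linear A -> A}) : Prop :=
  [/\ automorphism f, f \o f =1 id & ~ f =1 id].

Definition has_table_Td g h (e i j k : A) : Prop :=
  basis_of fullv [:: e; i; j; k] /\
  [seq [seq x ** y | y <- [:: e; i; j; k]] | x <- [:: e; i; j; k]] =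
  [:: [:: e;   i;   j;   k];
      [:: i; - e; - k;   j];
      [:: j;   k; - e; - i];
      [:: k; - j;   i;   g *: e + h *: i]].

End Algebra.

Definition isomorphic (R : realType) (A B : algebra R) : Prop :=
  exists f : {linear A -> B}, bijective f /\ {morph f : x y / x ** y >-> x ** y}.

Section Quaternions.
Variable R : realType.

(* (a, b, c, d) stands for a + b i + c j + d k, where i^2 = j^2 = k^2 = ijk = -1. *)
Definition quat : vectType R := (R^o * R^o * R^o * R^o)%type.

Definition quat_mul (x y : quat) : quat :=
  let: (a1, b1, c1, d1) := x in
  let: (a2, b2, c2, d2) := y in
  (a1 * a2 - b1 * b2 - c1 * c2 - d1 * d2,
   a1 * b2 + b1 * a2 + c1 * d2 - d1 * c2,
   a1 * c2 - b1 * d2 + c1 * a2 + d1 * b2,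
   a1 * d2 + b1 * c2 - c1 * b2 + d1 * a2).

Fact quat_mul_is_bilinear : bilinear_for *:%R *:%R quat_mul.
Proof.
split.
- move=> [[[a1 b1] c1] d1] a [[[a2 b2] c2] d2] [[[a3 b3] c3] d3] /=.
  congr (_, _, _, _); rewrite /= /GRing.scale /=; ring.
- move=> [[[a1 b1] c1] d1] a [[[a2 b2] c2] d2] [[[a3 b3] c3] d3] /=.
  congr (_, _, _, _); rewrite /= /GRing.scale /=; ring.
Qed.

HB.instance Definition _ :=
  bilinear_isBilinear.Build R quat quat quat *:%R *:%R quat_mul
    quat_mul_is_bilinear.

Definition quaternion_algebra : algebra R := Algebra quat_mul.

End Quaternions.

(* Main.v *)
(* A reflection f grades A as U + V, with U and V the eigenspaces of f for 1
   and -1. Multiplication by a nonzero element of V swaps U and V injectively,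
   so both are planes, and U is a copy of the complex numbers spanned by 1 and
   some i. A third imaginary unit has a nonzero component c in V, and V is
   spanned by c and ci. Writing ic = xc + y(ci), partial alternativity makes
   (x + iy)^2 = -1, whence ic = ci or ic = -ci. The first case forces
   c^2 = -1 = i^2, hence c = i or c = -i, which is absurd; in the second one
   c^2 is a negative real, and a multiple j of c is an imaginary unit with
   i, j, k = ji satisfying the table. *)
From HB Require Import structures.
Require Import Defs.
From mathcomp Require Import all_boot all_order all_algebra.
From mathcomp Require Import boolp classical_sets reals ring lra.

Set Implicit Arguments.
Unset Strict Implicit.
Unset Printing Implicit Defensive.

Import Order.TTheory GRing.Theory Num.Theory.
Local Open Scope ring_scope.
Local Open Scope algebra_scope.

(** * Linear combinations and coordinates in a vector space *)

Section Vectors.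
Variables (K : fieldType) (V : vectType K).
Implicit Types u v w : V.

Lemma coords_inj u v :
  (forall n, coord (vbasis fullv) n u = coord (vbasis fullv) n v) -> u = v.
Proof.
move=> uv; rewrite (coord_vbasis (memvf u)) (coord_vbasis (memvf v)).
by apply: eq_bigr => n _; rewrite uv.
Qed.

Lemma mem_span2 w u v :
  w \in <<[:: u; v]>>%VS -> exists a b, w = a *: u + b *: v.
Proof.
rewrite span_cons span_seq1 => /memv_addP[_ /vlineP[a ->] [_ /vlineP[b ->] ->]].
by exists a, b.
Qed.

Lemma free2_eq0 u v a b :
  free [:: u; v] -> a *: u + b *: v = 0 -> a = 0 /\ b = 0.
Proof.
move=> /(@freeP _ _ 2 [tuple u; v]) uv0 ab0.
have /uv0 uvc : \sum_(n < 2) (fun n => if n == ord0 then a else b) n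
    *: [:: u; v]`_n = 0 by rewrite !big_ord_recl big_ord0 addr0.
by split; [exact: (uvc ord0) | exact: (uvc ord_max)].
Qed.

End Vectors.

(** Read coordinatewise, an identity between linear combinations of vectors becomes a polynomial
    identity in scalars. *)
Ltac vect_ring :=
  apply: coords_inj => ?; rewrite !(linearD, linearN, linearZ) /= ?linear0; first [ring | field].

(** * Bilinearity rules and uniqueness of the unit *)

Section Products.
Variables (R : realType) (A : algebra R).
Implicit Types (e x y z : A) (a : R).

Lemma amulDl x y z : (x + y) ** z = x ** z + y ** z.
Proof. exact: linearDl. Qed.
Lemma amulDr x y z : z ** (x + y) = z ** x + z ** y.
Proof. exact: linearDr. Qed.
Lemma amulNl x y : (- x) ** y = - (x ** y).
Proof. exact: linearNl. Qed.
Lemma amulNr x y : x ** (- y) = - (x ** y).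
Proof. exact: linearNr. Qed.
Lemma amulZl a x y : (a *: x) ** y = a *: (x ** y).
Proof. exact: linearZl_LR. Qed.
Lemma amulZr a x y : x ** (a *: y) = a *: (x ** y).
Proof. exact: linearZr_LR. Qed.
Lemma amul0l x : 0 ** x = 0 :> A.
Proof. exact: linear0l. Qed.
Lemma amul0r x : x ** 0 = 0 :> A.
Proof. exact: linear0r. Qed.

Definition amulE := (amulDl, amulDr, amulNl, amulNr, amulZl, amulZr, amul0l, amul0r).

Lemma unit_uniq e e' : is_unit e -> is_unit e' -> e = e'.
Proof. by move=> ue ue'; rewrite -(ue e').1 (ue' e).2. Qed.

End Products.

(** * Computing in an algebra with the table *)

Section Table.
Variables (R : realType) (A : algebra R) (g h : R) (e i j k : A).
Hypothesis Td : has_table_Td g h e i j k.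

Definition comb (a b c d : R) : A := a *: e + b *: i + c *: j + d *: k.

Lemma comb_surj x : exists a b c d, x = comb a b c d.
Proof.
pose X := [tuple e; i; j; k].
have := @coord_basis _ _ _ _ X x Td.1 (memvf x).
rewrite !big_ord_recl big_ord0 addr0 !addrA /= => ->.
by do 4! eexists.
Qed.

Lemma coord_comb a b c d (X := [tuple e; i; j; k]) :
  [/\ coord X ord0 (comb a b c d) = a,
      coord X (inord 1) (comb a b c d) = b,
      coord X (inord 2) (comb a b c d) = c &
      coord X (inord 3) (comb a b c d) = d].
Proof.
have freeX : free X := basis_free Td.1.
pose s := [:: a; b; c; d].
have -> : comb a b c d = \sum_(n < 4) s`_n *: X`_n.
  by rewrite !big_ord_recl big_ord0 addr0 !addrA.
by rewrite !coord_sum_free // !inordK.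
Qed.

Lemma comb_eq0 a b c d : comb a b c d = 0 -> [/\ a = 0, b = 0, c = 0 & d = 0].
Proof.
have [ea eb ec ed] := coord_comb a b c d => x0.
by move: ea eb ec ed; rewrite x0 !linear0 => <- <- <- <-.
Qed.

Lemma mul_comb a b c d a' b' c' d' :
  comb a b c d ** comb a' b' c' d' =
  comb (a * a' - b * b' - c * c' + g * (d * d'))
       (a * b' + b * a' - c * d' + d * c' + h * (d * d'))
       (a * c' + c * a' + b * d' - d * b')
       (a * d' + d * a' - b * c' + c * b').
Proof.
have [_ [E11 E12 E13 E14 E21 E22 E23 E24 E31 E32 E33 E34 E41 E42 E43 E44]] := Td.
rewrite /comb !amulE E11 E12 E13 E14 E21 E22 E23 E24 E31 E32 E33 E34.
rewrite E41 E42 E43 E44; vect_ring.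
Qed.

Lemma table_unit : is_unit e.
Proof.
have [_ [E11 E12 E13 E14 E21 E22 E23 E24 E31 E32 E33 E34 E41 E42 E43 E44]] := Td.
move=> x; have [a [b [c [d ->]]]] := comb_surj x.
by rewrite /comb !amulE E11 E12 E13 E14 E21 E31 E41.
Qed.

Lemma imaginary_comb a b c d : imaginary_units e (comb a b c d) ->
  [/\ a ^+ 2 - b ^+ 2 - c ^+ 2 + g * d ^+ 2 = - 1,
      2 * a * b + h * d ^+ 2 = 0, a * c = 0 & a * d = 0].
Proof.
rewrite /imaginary_units /= mul_comb => /eqP; rewrite -subr_eq0 => /eqP q0.
(* [i], [j], [k] anticommute pairwise, so every mixed term of the square not involving [a]
   cancels. *)
have : comb (a ^+ 2 - b ^+ 2 - c ^+ 2 + g * d ^+ 2 + 1)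
  (2 * a * b + h * d ^+ 2) (2 * (a * c)) (2 * (a * d)) = 0.
  by rewrite -q0 /comb; vect_ring.
by move=> /comb_eq0[*]; split; lra.
Qed.

Lemma table_i_imaginary : imaginary_units e i.
Proof. by have [_ [_ _ _ _ _ ? _ _ _ _ _ _ _ _ _ _]] := Td. Qed.

(** Every product formed here has a factor in the span of [e], [i], [j], so [k ** k], the only entry
    where the table can depart from the quaternions, never enters. For [h != 0] every imaginary unit
    will turn out to have the form of [x]. *)
Lemma table_associator_imaginary b c y (x := comb 0 b c 0) :
  imaginary_units e x ->
  [/\ associator x x y = 0, associator x y x = 0 & associator y x x = 0].
Proof.
move=> /imaginary_comb[bc _ _ _].
have c2 : c ^+ 2 = 1 - b ^+ 2 by lra.
have [a [b' [c' [d ->]]]] := comb_surj y.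
split; rewrite /associator !mul_comb /comb;
  apply: coords_inj => n; rewrite !(linearD, linearN, linearZ) /= linear0;
  ring: c2.
Qed.

End Table.

(** * Imaginary units in a unital division algebra *)

Section DivisionAlgebra.
Variables (R : realType) (A : algebra R).
Hypothesis divA : division_algebra A.
Variable e : A.
Hypothesis unit_e : is_unit e.
Implicit Types (x y : A) (U V : {vspace A}).

Lemma amul_eq0 x y : x ** y = 0 -> x = 0 \/ y = 0.
Proof.
have [-> | x0] := eqVneq x 0; first by left.
move=> xy0; right; have [/bij_inj injx _] := divA x0.
by apply: injx; rewrite xy0 amul0r.
Qed.

Let mul1 x : e ** x = x. Proof. exact: (unit_e x).1. Qed.
Let mulx1 x : x ** e = x. Proof. exact: (unit_e x).2. Qed.

(** For commuting elements the difference of squares factors as [(x - y) ** (x + y)], and there are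
    no zero divisors. *)
Lemma commuting_sqr_eq x y : x ** y = y ** x -> x ** x = y ** y ->
  x = y \/ x = - y.
Proof.
move=> cxy sxy; have /amul_eq0[/eqP|/eqP] : (x - y) ** (x + y) = 0.
- by rewrite !amulE cxy sxy; vect_ring.
- by rewrite subr_eq0 => /eqP; left.
- by rewrite addr_eq0 => /eqP; right.
Qed.

(** If [a >= 0], then [x] and [Num.sqrt a *: e] commute and have equal squares, so [x] would be
    real. Hence [a < 0], and dividing by the square root of [- a] normalizes the square. *)
Lemma scaled_imaginary x a : x \notin <[e]>%VS -> x ** x = a *: e ->
  exists2 t, t != 0 & imaginary_units e (t *: x).
Proof.
move=> xNe xx; have [a0 | a0] := lerP 0 a.
  have [x_s | x_s] : x = Num.sqrt a *: e \/ x = - (Num.sqrt a *: e).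
    apply: commuting_sqr_eq; rewrite !amulE ?mul1 ?mulx1 //.
    by rewrite xx scalerA -expr2 sqr_sqrtr.
  - by rewrite x_s memvZ ?memv_line in xNe.
  - by rewrite x_s -scaleNr memvZ ?memv_line in xNe.
have s0 : 0 < Num.sqrt (- a) by rewrite sqrtr_gt0 oppr_gt0.
exists (Num.sqrt (- a))^-1; first by rewrite invr_eq0 gt_eqF.
rewrite /imaginary_units /= !amulE xx !scalerA -expr2 exprVn
  sqr_sqrtr ?oppr_ge0 1?ltW //.
by rewrite invrN mulNr mulVf ?lt_eqF // scaleN1r.
Qed.

Lemma plane_imaginary U : \dim U = 2%N -> e \in U ->
  (forall x y, x \in U -> y \in U -> x ** y \in U) ->
  exists2 i, imaginary_units e i & U = <<[:: e; i]>>%VS.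
Proof.
move=> dimU Ue UM.
have e0 : e != 0.
  apply: contra_eq_neq dimU => e0.
  have /eqP -> : U == 0%VS.
    by rewrite -subv0; apply/subvP => x _; rewrite -[x]mul1 e0 amul0l mem0v.
  by rewrite dimv0.
have spanU u : u \in U -> u \notin <[e]>%VS -> U = <<[:: e; u]>>%VS.
  move=> Uu uNe; apply/esym/span_basis; rewrite basisEfree dimU leqnn andbT.
  rewrite (perm_free (_ : perm_eq _ [:: u; e])); last by rewrite (perm_catC [:: e]).
  rewrite free_cons span_seq1 uNe seq1_free e0 /=.
  by apply/span_subvP => w; rewrite !inE => /orP[]/eqP->.
have [u Uu uNe] : exists2 u, u \in U & u \notin <[e]>%VS.
  apply/subvPn; apply: contra_eqN dimU => /dimvS.
  by rewrite dim_vline e0; case: (\dim U) => [|[|]].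
have [a [b uu]] : exists a b, u ** u = a *: e + b *: u.
  by apply: mem_span2; rewrite -(spanU u) // UM.
(* Completing the square: the [u] term of [u ** u] disappears and [v ** v] is real. *)
pose v := u - (b / 2) *: e.
have vNe : v \notin <[e]>%VS by rewrite rpredBr // memvZ // memv_line.
have Uv : v \in U by rewrite memvB // memvZ.
have vv : v ** v = (a + b ^+ 2 / 4) *: e.
  by rewrite /v !amulE uu !mul1 mulx1; vect_ring.
have [t t0 ti] := scaled_imaginary vNe vv.
exists (t *: v) => //; apply: spanU; first exact: memvZ.
by rewrite rpredZeq negb_or t0.
Qed.

Lemma dim_mul_img x U : x != 0 -> \dim (linfun (amul A x) @: U) = \dim U.
Proof.
move=> x0; apply: limg_dim_eq.
suff /eqP -> : lker (linfun (amul A x)) == 0%VS by rewrite capv0.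
apply/lker0P => y z; rewrite !lfunE /=.
by have [/bij_inj injx _] := divA x0; apply: injx.
Qed.

Lemma mul_img_sub x U V : (forall y, y \in U -> x ** y \in V) ->
  (linfun (amul A x) @: U <= V)%VS.
Proof.
by move=> UV; apply/subvP => _ /memv_imgP[y Uy ->]; rewrite lfunE UV.
Qed.

End DivisionAlgebra.

(** * The grading by the eigenspaces of a reflection *)

Section Reflection.
Variables (R : realType) (A : algebra R) (f : {linear A -> A}).
Hypotheses (divA : division_algebra A) (dimA : \dim {: A} = 4%N).
Hypothesis refl_f : reflection f.

Definition even_part : {vspace A} := lker (linfun f - \1%VF).
Definition odd_part : {vspace A} := lker (linfun f + \1%VF).

Lemma mem_even x : (x \in even_part) = (f x == x).
Proof. by rewrite memv_ker add_lfunE opp_lfunE id_lfunE lfunE subr_eq0. Qed.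

Lemma mem_odd x : (x \in odd_part) = (f x == - x).
Proof. by rewrite memv_ker add_lfunE id_lfunE lfunE addr_eq0. Qed.

Let fM x y : f (x ** y) = f x ** f y.
Proof. by have [[_ ->]] := refl_f. Qed.

Lemma even_mul_even x y :
  x \in even_part -> y \in even_part -> x ** y \in even_part.
Proof. by rewrite !mem_even fM => /eqP-> /eqP->. Qed.

Lemma even_mul_odd x y : x \in even_part -> y \in odd_part -> x ** y \in odd_part.
Proof. by rewrite mem_even !mem_odd fM => /eqP-> /eqP->; rewrite amulNr. Qed.

Lemma odd_mul_even x y : x \in odd_part -> y \in even_part -> x ** y \in odd_part.
Proof. by rewrite mem_even !mem_odd fM => /eqP-> /eqP->; rewrite amulNl. Qed.

Lemma odd_mul_odd x y : x \in odd_part -> y \in odd_part -> x ** y \in even_part.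
Proof.
by rewrite mem_even !mem_odd fM => /eqP-> /eqP->; rewrite amulNl amulNr opprK.
Qed.

Lemma even_unit e : is_unit e -> e \in even_part.
Proof.
move=> ue; rewrite mem_even; apply/eqP.
have [[[f' fK f'K] _] _ _] := refl_f.
(* With [e = f (f' e)], the product [e ** f e] becomes [f (f' e ** e) = e]. *)
by rewrite -[LHS](ue _).1 -[X in X ** _]f'K -fM (ue _).2 f'K.
Qed.

Lemma even_odd_eq0 x : x \in even_part -> x \in odd_part -> x = 0.
Proof.
rewrite mem_even mem_odd => /eqP-> /eqP xN.
apply: coords_inj => n; move/(congr1 (coord (vbasis fullv) n)): xN.
by rewrite linearN linear0; lra.
Qed.

Lemma even_odd_decomp x :
  exists a b, [/\ a \in even_part, b \in odd_part & x = a + b].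
Proof.
have [_ fK _] := refl_f; have ffx : f (f x) = x := fK x.
exists (2^-1 *: (x + f x)), (2^-1 *: (x - f x)); split.
- by rewrite mem_even linearZ linearD /= ffx addrC.
- by rewrite mem_odd linearZ linearB /= ffx -scalerN opprB.
- by vect_ring.
Qed.

Lemma even_odd_dim : \dim even_part = 2%N /\ \dim odd_part = 2%N.
Proof.
(* Without a nonzero odd element [f] would fix everything. *)
have [c Vc c0] : exists2 c, c \in odd_part & c != 0.
  apply: boolp.contrapT => V0; have [_ _] := refl_f; apply => x.
  have [a [b [/[!mem_even]/eqP fa Vb ->]]] := even_odd_decomp x.
  have [->|b0] := eqVneq b 0; first by rewrite addr0.
  by exfalso; apply: V0; exists b.
have UV : (even_part :&: odd_part = 0)%VS.
  apply/eqP; rewrite -subv0; apply/subvP => x; rewrite memv_cap memv0.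
  by case/andP=> Ux Vx; rewrite (even_odd_eq0 Ux Vx).
have : (\dim even_part + \dim odd_part = 4)%N.
  rewrite -(dimv_disjoint_sum UV) -dimA; congr (\dim _); apply/eqP.
  rewrite eqEsubv subvf /=; apply/subvP => x _.
  by have [a [b [Ua Vb ->]]] := even_odd_decomp x; apply: memv_add.
(* Left multiplication by [c] is injective and exchanges parity, so each dimension bounds the
   other. *)
have leUV : (\dim even_part <= \dim odd_part)%N.
  rewrite -(dim_mul_img divA even_part c0); apply/dimvS/mul_img_sub => y Uy.
  exact: odd_mul_even.
have leVU : (\dim odd_part <= \dim even_part)%N.
  rewrite -(dim_mul_img divA odd_part c0); apply/dimvS/mul_img_sub => y Vy.
  exact: odd_mul_odd.
have -> : \dim odd_part = \dim even_part by apply/eqP; rewrite eqn_leq leUV leVU.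
by case: (\dim even_part) => [|[|[|n]]] // /eqP; rewrite !addSn !addnS.
Qed.

End Reflection.

(** * From a third imaginary unit to the table *)

Section ThirdImaginaryUnit.
Variables (R : realType) (A : algebra R) (e : A).
Hypotheses (divA : division_algebra A) (unit_e : is_unit e).
Hypothesis altA : forall x y, imaginary_units e x ->
  [/\ associator x x y = 0, associator x y x = 0 & associator y x x = 0].

Let mul1 x : e ** x = x. Proof. exact: (unit_e x).1. Qed.
Let mulx1 x : x ** e = x. Proof. exact: (unit_e x).2. Qed.

Lemma imaginary_alternative i x : imaginary_units e i ->
  [/\ i ** (i ** x) = - x, (i ** x) ** i = i ** (x ** i) &
      (x ** i) ** i = - x].
Proof.
move=> Ii; have [/eqP + /eqP + /eqP] := altA x Ii.
rewrite !subr_eq0 (Ii : i ** i = - e) !amulE mul1 mulx1.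
by move=> /eqP<- /eqP-> /eqP->.
Qed.

Lemma commute_or_anticommute i c : imaginary_units e i ->
  free [:: c; c ** i] -> i ** c \in <<[:: c; c ** i]>>%VS ->
  i ** c = c ** i \/ i ** c = - (c ** i).
Proof.
move=> Ii free_c /mem_span2[x [y ic]].
have [iic ici cii] := imaginary_alternative c Ii.
(* Multiply [i ** c = x *: c + y *: (c ** i)] by [i] on the left, replace [i ** (c ** i)] by
   [(i ** c) ** i], and expand [i ** c] again: the result is [- c = (x ^+ 2 - y ^+ 2) *: c + (2 * x
   * y) *: (c ** i)]. *)
have [] := @free2_eq0 _ _ _ _ (x ^+ 2 - y ^+ 2 + 1) (2 * x * y) free_c.
  have : - c = x *: (i ** c) + y *: (i ** (c ** i)) by rewrite -iic {1}ic !amulE.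
  rewrite -ici {2}ic !amulE cii ic => cE.
  by rewrite -[RHS](addNr c) cE; vect_ring.
move=> xy1 xy0.
(* Otherwise [y = 0] and [x ^+ 2 = - 1]. *)
have x0 : x = 0 by nra.
have /eqP : (y - 1) * (y + 1) = 0 by move: xy1; rewrite x0; lra.
rewrite mulf_eq0 subr_eq0 addr_eq0 ic x0 scale0r add0r => /orP[]/eqP->.
- by left; rewrite scale1r.
- by right; rewrite scaleN1r.
Qed.

(** Alternativity for [i] and [j], with anticommutation, fixes every product except the square of
    [j ** i]. That square is even, as a product of odd elements, and its coordinates on [e] and [i]
    are [g] and [h]. *)
Lemma anticommuting_table (f : {linear A -> A}) i j :
  \dim {: A} = 4%N -> reflection f ->
  even_part f = <<[:: e; i]>>%VS -> odd_part f = <<[:: j; j ** i]>>%VS ->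
  imaginary_units e i -> imaginary_units e j -> i ** j = - (j ** i) ->
  exists g h, has_table_Td g h e i j (j ** i).
Proof.
move=> dimA refl_f evenE oddE Ii Ij ij.
have [iij iji jii] := imaginary_alternative j Ii.
have [jji jij _] := imaginary_alternative i Ij.
have [g [h kk]] : exists g h, (j ** i) ** (j ** i) = g *: e + h *: i.
  have odd_k : j ** i \in odd_part f by rewrite oddE memv_span // !inE eqxx orbT.
  by apply: mem_span2; rewrite -evenE (odd_mul_odd refl_f).
have ik : i ** (j ** i) = j by rewrite -[j ** i]opprK -ij amulNr iij opprK.
have kj : (j ** i) ** j = i by rewrite jij ij amulNr jji opprK.
exists g, h; split; last first.
  by rewrite /= !mul1 !mulx1 Ii Ij ij ik jji jii kj kk.
rewrite basisEdim dimA leqnn andbT; apply/subvP => x _.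
have [a [b [+ + ->]]] := even_odd_decomp refl_f x.
rewrite evenE oddE => /mem_span2[a0 [a1 ->]] /mem_span2[b0 [b1 ->]].
by rewrite !memvD ?memvZ ?memv_span // !inE eqxx ?orbT.
Qed.

Lemma reflection_table (f : {linear A -> A}) (p q r : A) :
  \dim {: A} = 4%N -> reflection f ->
  imaginary_units e p -> imaginary_units e q -> imaginary_units e r ->
  uniq [:: p; q; r] ->
  exists g h i j k, has_table_Td g h e i j k.
Proof.
move=> dimA refl_f Ip Iq Ir uniq_pqr.
have [dim_even dim_odd] := even_odd_dim divA dimA refl_f.
have even_e := even_unit refl_f unit_e.
have [i Ii evenE] :=
  plane_imaginary divA unit_e dim_even even_e (even_mul_even refl_f).
have even_i : i \in even_part f by rewrite evenE memv_span // !inE eqxx orbT.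
have eq_pm_i x : imaginary_units e x -> x ** i = i ** x -> x \in [:: i; - i].
  move=> Ix xi; have := commuting_sqr_eq divA xi (etrans Ix (esym Ii)).
  by case=> ->; rewrite !inE eqxx ?orbT.
(* Three distinct imaginary units cannot all lie in a list of two elements. *)
have [s Is sNi] : exists2 s, imaginary_units e s & s \notin [:: i; - i].
  have /allPn[s] : ~~ all (mem [:: i; - i]) [:: p; q; r].
    by apply/negP => /allP/(uniq_leq_size uniq_pqr).
  move=> s_pqr sN; exists s => //; move: s_pqr; rewrite !inE.
  by case/or3P => /eqP->.
have [a [c [even_a odd_c s_ac]]] := even_odd_decomp refl_f s.
have ai : a ** i = i ** a.
  move: even_a; rewrite evenE => /mem_span2[a0 [a1 ->]].
  by rewrite !amulE mul1 mulx1.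
(* If [c = 0], then [s = a] commutes with [i], so [s] is [i] or [- i]. *)
have c0 : c != 0.
  by apply: contraNneq sNi => c0; apply: eq_pm_i; rewrite // s_ac c0 addr0.
have oddE x : x \in odd_part f -> x != 0 -> odd_part f = <<[:: x; x ** i]>>%VS.
  move=> odd_x x0; apply/esym/eqP; rewrite eqEdim dim_odd.
  have -> : <<[:: x; x ** i]>>%VS = (linfun (amul A x) @: even_part f)%VS.
    by rewrite evenE limg_span /= !lfunE /= mulx1.
  rewrite dim_mul_img // dim_even leqnn andbT.
  by apply/mul_img_sub => y /(odd_mul_even refl_f odd_x).
have oddE_c := oddE c odd_c c0.
have free_c : free [:: c; c ** i] by rewrite /free -oddE_c dim_odd.
(* This is the odd component of [s ** s], and [s ** s = - e] is even. *)
have odd_anti : a ** c + c ** a = 0.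
  apply: (@even_odd_eq0 _ _ f); last first.
    by rewrite rpredD // ?(even_mul_odd refl_f even_a) ?(odd_mul_even refl_f odd_c).
  have -> : a ** c + c ** a = - e - a ** a - c ** c.
    by rewrite -(Is : s ** s = _) s_ac !amulE; vect_ring.
  rewrite !rpredB ?rpredN ?(even_mul_even refl_f even_a) //.
  exact: odd_mul_odd.
have [ic|ic] : i ** c = c ** i \/ i ** c = - (c ** i).
  by apply: commute_or_anticommute => //; rewrite -oddE_c (even_mul_odd refl_f).
(* In the commuting case [a] commutes with [c] too, so [odd_anti] gives [c ** a = 0]. Then [s = c]
   commutes with [i], contradicting the choice of [s]. *)
- have a0 : a = 0.
    have ac : a ** c = c ** a.
      move: even_a; rewrite evenE => /mem_span2[a0 [a1 ->]].
      by rewrite !amulE mul1 mulx1 ic.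
    have : 2 *: (c ** a) = 0 by rewrite -odd_anti ac; vect_ring.
    move/eqP; rewrite scaler_eq0 pnatr_eq0 /= => /eqP/(amul_eq0 divA)[/eqP|//].
    by rewrite (negPf c0).
  by move: sNi; rewrite eq_pm_i // s_ac a0 add0r ic.
have [a0 [a1 aE]] : exists a0 a1, a = a0 *: e + a1 *: i.
  by apply: mem_span2; rewrite -evenE.
(* Anticommutation reduces [odd_anti] to [(2 * a0) *: c = 0], so [a = a1 *: i]; the even component
   of [s ** s = - e] then yields [c ** c]. *)
have cc : c ** c = (a1 ^+ 2 - 1) *: e.
  have a00 : a0 = 0.
    have : (2 * a0) *: c = 0.
      by rewrite -odd_anti aE !amulE mul1 mulx1 ic; vect_ring.
    by move/eqP; rewrite scaler_eq0 (negPf c0) orbF => /eqP; lra.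
  have -> : c ** c = - e - a ** a - (a ** c + c ** a).
    by rewrite -(Is : s ** s = _) s_ac !amulE; vect_ring.
  rewrite odd_anti aE a00 !amulE !mul1 !mulx1 (Ii : i ** i = _); vect_ring.
have cNe : c \notin <[e]>%VS.
  apply: contra c0 => /vlineP[t c_te]; apply/eqP/(@even_odd_eq0 _ _ f) => //.
  by rewrite c_te memvZ.
have [t t0 It] := scaled_imaginary divA unit_e cNe cc.
have itc : i ** (t *: c) = - ((t *: c) ** i) by rewrite !amulE ic scalerN.
have oddE_tc : odd_part f = <<[:: t *: c; (t *: c) ** i]>>%VS.
  by apply: oddE; rewrite ?memvZ // scaler_eq0 negb_or t0.
have [g [h Td]] :=
  anticommuting_table dimA refl_f evenE oddE_tc Ii It itc.
by exists g, h, i, (t *: c), ((t *: c) ** i).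
Qed.

End ThirdImaginaryUnit.

(** * The case [g = -1], [h = 0]: associativity and the quaternions *)

Section Quaternions.
Variables (R : realType) (A : algebra R) (e i j k : A).

Lemma quaternion_table_associative (x y z : A) :
  has_table_Td (-1) 0 e i j k -> associator x y z = 0.
Proof.
move=> Td.
have [a [b [c [d ->]]]] := comb_surj Td x.
have [a' [b' [c' [d' ->]]]] := comb_surj Td y.
have [a'' [b'' [c'' [d'' ->]]]] := comb_surj Td z.
by rewrite /associator !(mul_comb Td) /comb; vect_ring.
Qed.

Lemma quaternion_table_isomorphic :
  has_table_Td (-1) 0 e i j k -> isomorphic A (quaternion_algebra R).
Proof.
move=> Td; pose X := [tuple e; i; j; k].
(* k = ji in the table, whereas k = ij in the quaternions. *)
pose f (x : A) : quat R :=
  (coord X ord0 x, coord X (inord 1) x, coord X (inord 2) x,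
   - coord X (inord 3) x).
have f_comb a b c d : f (comb e i j k a b c d) = (a, b, c, - d).
  by rewrite /f /X; have [-> -> -> ->] := coord_comb Td a b c d.
have linf : linear f.
  by move=> t x y; rewrite /f !linearP /= opprD -mulrN.
pose F : {linear A -> quaternion_algebra R} :=
  HB.pack f (GRing.isLinear.Build R A (quat R) _ f linf).
exists F; split.
  pose f' (q : quat R) := comb e i j k q.1.1.1 q.1.1.2 q.1.2 (- q.2).
  exists f' => [x | [[[a b] c] d]].
  - have [a [b [c [d ->]]]] := comb_surj Td x.
    by rewrite /F /= f_comb /f' /= opprK.
  - by rewrite /F /= f_comb opprK.
move=> x y.
have [a [b [c [d ->]]]] := comb_surj Td x.
have [a' [b' [c' [d' ->]]]] := comb_surj Td y.
rewrite (mul_comb Td) -[LHS]/(f _) -[RHS]/(quat_mul (f _) (f _)) !f_comb /=.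
congr (_, _, _, _); ring.
Qed.

End Quaternions.

(** * Existence of the table, its converse, and the case [h = 0] *)

Theorem theorem2 (R : realType) (A : algebra R)
    (dimA : \dim {: A} = 4%N) (divA : division_algebra A) :
  (forall e : A, is_unit e -> partially_alternative A ->
     (exists f : {linear A -> A}, reflection f) ->
     (exists p q r : A, [/\ imaginary_units e p, imaginary_units e q,
        imaginary_units e r & uniq [:: p; q; r]]) ->
     exists (g h : R) (i j k : A), has_table_Td g h e i j k)
  /\ (forall (g h : R) (e i j k : A),
        has_table_Td g h e i j k -> h != 0 -> partially_alternative A)
  /\ (forall (g : R) (e i j k : A),
        has_table_Td g 0 e i j k -> (partially_alternative A <-> g = -1))
  /\ (forall e i j k : A,
        has_table_Td (-1) 0 e i j k -> isomorphic A (quaternion_algebra R)).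
Proof.
split.
  move=> e ue [e' [ue' _ altA]] [f refl_f] [p [q [r [Ip Iq Ir]]]].
  move: altA; rewrite -(unit_uniq ue ue') => altA.
  exact: (reflection_table divA ue altA dimA refl_f Ip Iq Ir).
split.
  move=> g h e i j k Td h0; exists e; split.
  - exact: table_unit Td.
  - by exists i; apply: table_i_imaginary Td.
  move=> x y; have [a [b [c [d ->]]]] := comb_surj Td x => Ix.
  have [n1 n2 ac ad] := imaginary_comb Td Ix.
  (* If [a != 0], then [c = d = 0], next [b = 0] from [n2], and [n1] says [a ^+ 2 = - 1]. *)
  have a0 : a = 0.
    apply/eqP; move: ac ad => /eqP + /eqP; rewrite !mulf_eq0.
    case: eqVneq => //= a0 /eqP c0 /eqP d0; move: n2 n1; rewrite c0 d0.
    rewrite expr0n !mulr0 !addr0 subr0 => /eqP.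
    by rewrite !mulf_eq0 pnatr_eq0 (negPf a0) => /eqP ->; nra.
  have d0 : d = 0.
    move: n2; rewrite a0 mulr0 mul0r add0r => /eqP.
    by rewrite mulf_eq0 (negPf h0) sqrf_eq0 => /eqP.
  move: Ix; rewrite a0 d0 => Ix.
  exact: (table_associator_imaginary Td y Ix).
split; last by move=> e i j k; apply: quaternion_table_isomorphic.
move=> g e i j k Td; have ue := table_unit Td; split; last first.
  move=> gN1; move: Td; rewrite gN1 => Td; exists e; split => //.
  - by exists i; apply: table_i_imaginary Td.
  - by move=> x y _; split; apply: quaternion_table_associative Td.
move=> [e' [ue' _ altA]]; move: altA; rewrite -(unit_uniq ue ue') => altA.
(* For [h = 0] the square of [k] is real, so some [t *: k] is an imaginary unit. Alternativity of
   [t *: k] against [j], with [k ** (k ** j) = - j], forces [t ^+ 2 = 1]; then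
   [(t *: k) ** (t *: k) = - e] reads [g = -1]. *)
have k_comb : k = comb e i j k 0 0 0 1 by rewrite /comb; vect_ring.
have kk : k ** k = g *: e by rewrite k_comb (mul_comb Td) /comb; vect_ring.
have kkj : k ** (k ** j) = - j.
  have -> : j = comb e i j k 0 0 1 0 by rewrite /comb; vect_ring.
  by rewrite {1 2}k_comb !(mul_comb Td) /comb; vect_ring.
have kNe : k \notin <[e]>%VS.
  apply/negP => /vlineP[t kt].
  have /(comb_eq0 Td)[_ _ _ /eqP] : comb e i j k (- t) 0 0 1 = 0.
    by rewrite /comb kt; vect_ring.
  by rewrite oner_eq0.
have [t t0 It] := scaled_imaginary divA ue kNe kk.
have [ttj _ _] := imaginary_alternative ue altA j It.
have t2 : t ^+ 2 = 1.
  have /(comb_eq0 Td)[_ _ + _] : comb e i j k 0 0 (1 - t ^+ 2) 0 = 0; last lra.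
  have -> : comb e i j k 0 0 (1 - t ^+ 2) 0 = j + t *: (t *: (- j)).
    by rewrite /comb; vect_ring.
  by move: ttj; rewrite !amulE kkj => ->; rewrite subrr.
have : comb e i j k (1 + t ^+ 2 * g) 0 0 0 = 0.
  have -> : comb e i j k (1 + t ^+ 2 * g) 0 0 0 = e + (t *: (t *: (g *: e))).
    by rewrite /comb; vect_ring.
  by move: It; rewrite /imaginary_units /= !amulE kk => ->; rewrite subrr.
by move=> /(comb_eq0 Td)[+ _ _ _]; rewrite t2; lra.
Qed.
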